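(* For any $s\in\{2,3\}$ and any integers $a,b$ with $s<a\leq b$, there exists some $t_0$ such that for all integers $t\geq t_0$ we have $$\mathrm{ex}(n,K_{a,b},K_{s,t})=\Theta_{t,b}(n^s).$$
   Context: All graphs are finite and simple. For graphs $F$ and $H$ and a positive integer $n$, a graph is $H$-free if it does not contain $H$ as a (not necessarily induced) subgraph, and the generalized Turán number $\mathrm{ex}(n,F,H)$ denotes the maximum number of copies of $F$ (i.e. subgraphs, not necessarily induced, isomorphic to $F$) in an $H$-free graph on $n$ vertices. $K_{a,b}$ is the complete bipartite graph with parts of sizes $a$ and $b$. The notation $\Theta_{t,b}(n^s)$ is asymptotic as $n\to\infty$ and means that the function is bounded above and below, for all sufficiently large $n$, by positive constants (which may depend on $t$ and $b$) times $n^s$. *)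

(* Defs.v *)
From HB Require Import structures.
From mathcomp Require Import all_boot.

Set Implicit Arguments.
Unset Strict Implicit.
Unset Printing Implicit Defensive.

(* Finite simple graphs with vertex set T, given by their sets of edges. *)
Record sgraph (T : finType) := SGraph {
  edges : {set {set T}};
  edges_card2 : [forall e in edges, #|e| == 2] }.

HB.instance Definition _ (T : finType) := [isSub for @edges T].
HB.instance Definition _ (T : finType) := [Finite of sgraph T by <:].

(* A pair S = (W, D) stands for the graph with vertex set W and edge set D. *)
Definition subgraph (T : finType) (S : {set T} * {set {set T}})
    (G : sgraph T) : bool :=
  (S.2 \subset edges G) && [forall e in S.2, e \subset S.1].

(* On the diagonal x = y both sides of the last equation are false, since edges
   have two elements. *)
Definition isomorphism (V T : finType) (F : sgraph V)
    (S : {set T} * {set {set T}}) (f : {ffun V -> T}) : bool :=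
  [&& injectiveb f, f @: [set: V] == S.1 &
    [forall x, forall y, ([set x; y] \in edges F) == ([set f x; f y] \in S.2)]].

Definition isomorphic (V T : finType) (F : sgraph V)
    (S : {set T} * {set {set T}}) : bool :=
  [exists f : {ffun V -> T}, isomorphism F S f].

Definition copies (V T : finType) (F : sgraph V) (G : sgraph T) :
    {set {set T} * {set {set T}}} :=
  [set S | subgraph S G & isomorphic F S].

Definition free (V T : finType) (H : sgraph V) (G : sgraph T) : bool :=
  copies H G == set0.

(* The maximum over an empty family is 0; this only matters when even the
   edgeless graph on n vertices contains H. *)
Definition ex (n : nat) (V U : finType) (F : sgraph V) (H : sgraph U) : nat :=
  \max_(G : sgraph 'I_n | free H G) #|copies F G|.

Definition Kedges (a b : nat) : {set {set 'I_a + 'I_b}} :=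
  [set [set inl p.1; inr p.2] | p in [set: 'I_a * 'I_b]].

Lemma Kedges_card2 (a b : nat) : [forall e in Kedges a b, #|e| == 2].
Proof.
by apply/forall_inP => _ /imsetP[[i j] _ ->]; rewrite cards2.
Qed.

Definition K (a b : nat) : sgraph ('I_a + 'I_b)%type := SGraph (Kedges_card2 a b).

(* Main.v *)
Require Import Defs.
From mathcomp Require Import all_boot all_order all_algebra.
From mathcomp Require Import all_field reals zify ring.
From mathcomp Require boolp.

(** Upper bound. In a graph without [K_{s,t}], any [s] vertices have fewer than
    [t] common neighbours. Choose [s] vertices of the part of size [a] of a copy
    of [K_{a,b}] in at most [n ^ s] ways; then each vertex of the other part has
    at most [t] possible positions, and after that so does each remaining vertex
    of the first part ([ex_ub]).

    Lower bound. Let [F] be a field with [q] elements. It is enough to find a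
    bipartite graph on two copies of [F ^ s], without [K_{s,t}] for some constant
    [t], that contains [K_{a,b}] on the order of [q ^ (s * s)] times
    ([ex_lb_powers]; powers of one prime are dense enough among the integers).
    The count [s * s] is that of [s]-dimensional subspaces of [F ^ (2 * s)]. In
    both constructions adjacency is a bilinear equation between images of the two
    vertices in such a space, up to finitely many correction terms; a copy of
    [K_{a,b}] is a subspace that contains the images of [a] vertices of one side
    while its annihilator contains the images of [b] vertices of the other.

    For [s = 2] the graph is [z + w = pi (u * v)] with [pi x = x - x ^+ p] on a
    field of characteristic [p > b]. Two vertices determine [u] up to [p] values,
    because [pi] is an additive polynomial of degree [p]. As [pi] kills the prime
    field, progressions [v + beta * i] and [u + j / beta] of length at most [p]
    on the two sides are completely joined: [pi] of the cross term [j * i]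
    vanishes. The four free parameters [u], [v], [beta] and an offset give the
    [q ^ 4] copies.

    For [s = 3] a vertex is a pair [(z, v)] of a point [z] of the plane [F ^ 2]
    and a scalar [v]. The graph is a variant of the unit sphere graph, with the
    anisotropic quadratic form [qnorm]:
    [qnorm (z + w) = u^2 v + u v^2 + u^2 + v^2 + C + C'].
    Three vertices on one side confine [w] to three circles of this form, with
    centres independent of [u] and squared radii polynomial in [u]; the cubic terms
    make the resulting equation for [u] nontrivial ([card_common_nbrs_le4]). If [C]
    and [C'] were constant, the copies described below would have at most four
    vertices on each side, the roots of a quartic. So [C] takes [a] values and [C']
    takes [b] values, selected by colourings. Different colours must not share a
    scalar [v] (three circles with collinear centres could have common points for
    every [u]), nor a point [z] (three concentric circles could coincide): both [v]
    and [z] are coloured, and only the pairs [(z, v)] of equal colours get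
    neighbours. Such a copy consists of a quadratic curve [z = A v] and a quadratic
    function [B], nine scalars in all, and of arbitrary scalars [v_i] and [u_j];
    these prescribe the values of [C], [C'] and finitely many colours. Each such
    datum is compatible with a fixed proportion, of order [q ^- (a + b)], of all
    choices of [C], [C'] and colourings, and there are about [q ^ (9 + a + b)]
    data, so that by averaging some choice realizes about [q ^ 9] of them
    ([exists_palettes]). *)

Set Implicit Arguments.
Unset Strict Implicit.
Unset Printing Implicit Defensive.

Import Order.TTheory GRing.Theory Num.Theory.

(** * Labelled copies of complete bipartite graphs *)

Definition embeddings (T : finType) (a b : nat) (G : sgraph T) :
    {set {ffun 'I_a + 'I_b -> T}} :=
  [set f : {ffun _ -> T} | injectiveb f &
    [forall i, forall j, [set f (inl i); f (inr j)] \in edges G]].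

(** The subgraph traced by [f]; a pair in the sense of [subgraph]. *)
Definition image_copy (T : finType) (a b : nat) (f : {ffun 'I_a + 'I_b -> T}) :
    {set T} * {set {set T}} :=
  (f @: [set: 'I_a + 'I_b], [set f @: (e : {set _}) | e in edges (K a b)]).

Lemma embeddingsP (T : finType) (a b : nat) (G : sgraph T)
    (f : {ffun 'I_a + 'I_b -> T}) :
  reflect (injective f /\ forall i j, [set f (inl i); f (inr j)] \in edges G)
          (f \in embeddings a b G).
Proof.
rewrite inE; apply: (iffP andP) => [[/injectiveP fI /forallP fE]|[fI fE]].
  by split=> // i j; apply: (forallP (fE i)).
by split; [apply/injectiveP | apply/forallP => i; apply/forallP => j].
Qed.

Lemma imset_pair (S T : finType) (f : S -> T) (x y : S) :
  f @: [set x; y] = [set f x; f y].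
Proof. by rewrite imsetU !imset_set1. Qed.

Lemma edge_pair (T : finType) (G : sgraph T) (e : {set T}) :
  e \in edges G -> exists x y, x != y /\ e = [set x; y].
Proof.
by move=> eG; apply/cards2P/(forall_inP (edges_card2 G)).
Qed.

Lemma Kedge (a b : nat) (i : 'I_a) (j : 'I_b) :
  [set inl i; inr j] \in edges (K a b).
Proof. by apply/imsetP; exists (i, j). Qed.

Lemma image_copy_copies (T : finType) (a b : nat) (G : sgraph T)
    (f : {ffun 'I_a + 'I_b -> T}) :
  f \in embeddings a b G -> image_copy f \in copies (K a b) G.
Proof.
case/embeddingsP => fI fE; rewrite inE; apply/andP; split.
  apply/andP; split.
    apply/subsetP => _ /imsetP[_ /imsetP[[i j] _ ->] ->].
    by rewrite imset_pair /= fE.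
  by apply/forall_inP => _ /imsetP[e _ ->]; rewrite imsetS ?subsetT.
apply/existsP; exists f; apply/and3P; split=> //; first exact/injectiveP.
apply/forallP => x; apply/forallP => y; apply/eqP.
by rewrite -imset_pair mem_imset //; apply: imset_inj.
Qed.

(** A copy is recovered from any isomorphism onto it: its edges lie inside its
    vertex set, so that each of them is the image of a pair of vertices. *)
Lemma copies_image_copy (T : finType) (a b : nat) (G : sgraph T)
    (S : {set T} * {set {set T}}) :
  S \in copies (K a b) G -> exists2 f, f \in embeddings a b G & S = image_copy f.
Proof.
rewrite inE => /andP[/andP[SG SW] /existsP[f /and3P[/injectiveP fI /eqP fS fE]]].
have {}fE x y : ([set x; y] \in edges (K a b)) = ([set f x; f y] \in S.2).
  by apply/eqP/(forallP (forallP fE x) y).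
exists f.
  by apply/embeddingsP; split=> // i j; apply: (subsetP SG); rewrite -fE Kedge.
case: S SG SW fS fE => W D /= SG SW fS fE; congr (_, _) => //; apply/setP => e.
apply/idP/imsetP => [eD|[_ /imsetP[[i j] _ ->] ->]]; last first.
  by rewrite imset_pair -fE Kedge.
have [x [y [_ ee]]] := edge_pair (subsetP SG _ eD).
have /subsetP eW := forall_inP SW _ eD.
have /imsetP[x' _ ex] : x \in f @: [set: 'I_a + 'I_b].
  by rewrite fS eW // ee !inE eqxx.
have /imsetP[y' _ ey] : y \in f @: [set: 'I_a + 'I_b].
  by rewrite fS eW // ee !inE eqxx orbT.
have ef : e = [set f x'; f y'] by rewrite ee ex ey.
by exists [set x'; y']; rewrite ?imset_pair // fE -ef.
Qed.

Lemma card_copies_le (T : finType) (a b : nat) (G : sgraph T) :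
  #|copies (K a b) G| <= #|embeddings a b G|.
Proof.
apply: leq_trans (leq_imset_card (@image_copy T a b) _).
apply/subset_leq_card/subsetP => S /copies_image_copy[f fJ ->].
exact: imset_f.
Qed.

(** All embeddings with the same image land in its [a + b] vertices, whence the
    factor. Together with [card_copies_le] this lets embeddings be counted in place
    of copies, up to a constant. *)
Lemma card_embeddings_le (T : finType) (a b : nat) (G : sgraph T) :
  #|embeddings a b G| <= (a + b) ^ (a + b) * #|copies (K a b) G|.
Proof.
rewrite -sum1_card (partition_big (@image_copy T a b)
  (mem (copies (K a b) G))) /=; last exact: image_copy_copies.
rewrite mulnC -sum_nat_const; apply: leq_sum => S _.
rewrite sum1_card.
case: (pickP (fun f => (f \in embeddings a b G) && (image_copy f == S))) => [g|H];
  last by rewrite eq_card0.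
move=> /andP[/embeddingsP[gI _] /eqP gS].
have cS : #|S.1| = a + b.
  by rewrite -gS card_imset // cardsT card_sum !card_ord.
have cab : #|{: 'I_a + 'I_b}| = a + b by rewrite card_sum !card_ord.
rewrite -[X in X ^ _]cS -[X in _ ^ X]cab -card_ffun_on.
apply/subset_leq_card/subsetP => f /andP[_ /eqP <-].
by apply/ffun_onP => x; apply: imset_f.
Qed.

Lemma free_embeddings (T : finType) (s t : nat) (G : sgraph T) :
  Defs.free (K s t) G = (embeddings s t G == set0).
Proof.
rewrite /Defs.free -!cards_eq0; apply/eqP/eqP => [c0|j0]; apply/eqP.
  by rewrite -leqn0 (leq_trans (card_embeddings_le _ _ _)) // c0 muln0.
by rewrite -leqn0 -j0 card_copies_le.
Qed.

(** * The upper bound *)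

Definition nbrs (T : finType) (G : sgraph T) (s : nat) (xs : 'I_s -> T) :
    {set T} := [set y | [forall i, [set xs i; y] \in edges G]].

Lemma nbrsP (T : finType) (G : sgraph T) (s : nat) (xs : 'I_s -> T) (y : T) :
  reflect (forall i, [set xs i; y] \in edges G) (y \in nbrs G xs).
Proof. by rewrite inE; apply: forallP. Qed.

Lemma edge_neq (T : finType) (G : sgraph T) (x y : T) :
  [set x; y] \in edges G -> x != y.
Proof.
move=> xyG; have := forall_inP (edges_card2 G) _ xyG.
by rewrite cards2; case: (x == y).
Qed.

(** The [s] vertices are automatically distinct from their common neighbours,
    since edges have two elements, so [t] common neighbours would complete a
    [K_{s,t}]. *)
Lemma card_nbrs_lt (T : finType) (G : sgraph T) (s t : nat) (xs : 'I_s -> T) :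
  embeddings s t G = set0 -> injective xs -> #|nbrs G xs| < t.
Proof.
move=> J0 xI; rewrite ltnNge; apply/negP => le_t.
pose ys (j : 'I_t) : T := enum_val (widen_ord le_t j).
have yN j : ys j \in nbrs G xs by apply: enum_valP.
have yI : injective ys by move=> j j' /enum_val_inj[/val_inj].
pose f : {ffun 'I_s + 'I_t -> T} := [ffun z =>
  match z with inl i => xs i | inr j => ys j end].
suff: f \in embeddings s t G by rewrite J0 inE.
apply/embeddingsP; split=> [z z'|i j]; last by rewrite !ffunE; apply/nbrsP/yN.
have neq i j : xs i <> ys j.
  by apply/eqP/edge_neq; have /nbrsP := yN j; apply.
rewrite !ffunE; case: z z' => [i|j] [i'|j'].
- by move=> /xI->.
- by move=> /neq.
- by move=> /esym/neq.
- by move=> /yI->.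
Qed.

Lemma index_enum_inj (T : finType) (A : {set T}) (t : nat) (y z : T) :
  #|A| <= t -> y \in A -> z \in A ->
  inord (index y (enum A)) = inord (index z (enum A)) :> 'I_t.+1 -> y = z.
Proof.
move=> At yA zA /(congr1 val); rewrite /= !inordK ?ltnS.
- move=> e; rewrite -(nth_index y (s := enum A) (x := y)) ?mem_enum // e.
  by rewrite nth_index ?mem_enum.
- by rewrite (leq_trans _ At) // cardE index_size.
- by rewrite (leq_trans _ At) // cardE index_size.
Qed.

(** An embedding is encoded by the images of the first [s] left vertices, the
    rank of each right vertex among the common neighbours of these, and the rank of
    each left vertex among the common neighbours of the first [s] right vertices. *)
Lemma card_embeddings_ub (T : finType) (G : sgraph T) (s t a b : nat) :
  embeddings s t G = set0 -> s <= a -> s <= b ->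
  #|embeddings a b G| <= #|T| ^ s * t.+1 ^ (a + b).
Proof.
move=> J0 sa sb.
pose xs (f : {ffun 'I_a + 'I_b -> T}) : {ffun 'I_s -> T} :=
  [ffun i => f (inl (widen_ord sa i))].
pose ys (f : {ffun 'I_a + 'I_b -> T}) : {ffun 'I_s -> T} :=
  [ffun i => f (inr (widen_ord sb i))].
pose cr (f : {ffun 'I_a + 'I_b -> T}) : {ffun 'I_b -> 'I_t.+1} :=
  [ffun j => inord (index (f (inr j)) (enum (nbrs G (xs f))))].
pose cl (f : {ffun 'I_a + 'I_b -> T}) : {ffun 'I_a -> 'I_t.+1} :=
  [ffun i => inord (index (f (inl i)) (enum (nbrs G (ys f))))].
have wI m (sm : s <= m) : injective (widen_ord sm) by move=> i j [/val_inj].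
have xsI f : f \in embeddings a b G -> injective (xs f).
  by case/embeddingsP => fI _ i j; rewrite !ffunE => /fI[/val_inj].
have ysI f : f \in embeddings a b G -> injective (ys f).
  by case/embeddingsP => fI _ i j; rewrite !ffunE => /fI[/val_inj].
have rN f j : f \in embeddings a b G -> f (inr j) \in nbrs G (xs f).
  by case/embeddingsP => _ fE; apply/nbrsP => i; rewrite ffunE.
have lN f i : f \in embeddings a b G -> f (inl i) \in nbrs G (ys f).
  by case/embeddingsP => _ fE; apply/nbrsP => j; rewrite ffunE setUC.
have inj : {in embeddings a b G &, injective (fun f => (xs f, (cl f, cr f)))}.
  move=> f g fJ gJ [ex el er].
  have eqr j : f (inr j) = g (inr j).
    apply: (@index_enum_inj _ (nbrs G (xs f)) t).
    - exact/ltnW/card_nbrs_lt/xsI.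
    - exact: rN.
    - by rewrite ex rN.
    - by move/ffunP/(_ j): er; rewrite !ffunE ex.
  have ey : ys f = ys g by apply/ffunP => i; rewrite !ffunE eqr.
  apply/ffunP => -[i|j]; last exact: eqr.
  apply: (@index_enum_inj _ (nbrs G (ys f)) t).
  - exact/ltnW/card_nbrs_lt/ysI.
  - exact: lN.
  - by rewrite ey lN.
  - by move/ffunP/(_ i): el; rewrite !ffunE ey.
rewrite -(card_in_imset inj); apply: leq_trans (max_card _) _.
by rewrite !card_prod !card_ffun !card_ord expnD.
Qed.

Lemma ex_ub (n s t a b : nat) :
  s <= a -> s <= b -> ex n (K a b) (K s t) <= n ^ s * t.+1 ^ (a + b).
Proof.
move=> sa sb; apply/bigmax_leqP => G; rewrite free_embeddings => /eqP J0.
apply: leq_trans (card_copies_le _ _ _) _.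
by rewrite -[X in X ^ s](card_ord n) card_embeddings_ub.
Qed.

(** * Bipartite graphs on a prescribed number of vertices *)

Definition bip_edges (X Y T : finType) (R : X -> Y -> bool) (g : X + Y -> T) :
    {set {set T}} :=
  [set [set g (inl p.1); g (inr p.2)] | p in [set p : X * Y | R p.1 p.2]].

Lemma bip_edges_card2 (X Y T : finType) (R : X -> Y -> bool) (g : X + Y -> T) :
  injective g -> [forall e in bip_edges R g, #|e| == 2].
Proof.
move=> gI; apply/forall_inP => _ /imsetP[[x y] _ ->].
by rewrite cards2 (inj_eq gI).
Qed.

(** The image of a bipartite graph under an injection of its vertices; the
    vertices outside the image are isolated. *)
Definition bip_graph (X Y T : finType) (R : X -> Y -> bool) (g : X + Y -> T)
  (gI : injective g) : sgraph T := SGraph (bip_edges_card2 R gI).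

Lemma set2_inj (T : finType) (x y z w : T) :
  [set x; y] = [set z; w] -> x = z /\ y = w \/ x = w /\ y = z.
Proof.
move=> e; have /set2P xzw : x \in [set z; w] by rewrite -e set21.
have /set2P yzw : y \in [set z; w] by rewrite -e set22.
have /set2P zxy : z \in [set x; y] by rewrite e set21.
have /set2P wxy : w \in [set x; y] by rewrite e set22.
by intuition congruence.
Qed.

Lemma bip_adj (X Y T : finType) (R : X -> Y -> bool) (g : X + Y -> T)
    (gI : injective g) (u v : T) :
  [set u; v] \in edges (bip_graph R gI) ->
  exists x y, R x y /\ (u = g (inl x) /\ v = g (inr y) \/
                        u = g (inr y) /\ v = g (inl x)).
Proof.
rewrite /= => /imsetP[[x y]]; rewrite inE /= => Rxy /set2_inj H.
by exists x, y.
Qed.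

Lemma bip_adjE (X Y T : finType) (R : X -> Y -> bool) (g : X + Y -> T)
    (gI : injective g) (x : X) (y : Y) :
  ([set g (inl x); g (inr y)] \in edges (bip_graph R gI)) = R x y.
Proof.
apply/idP/idP => [/bip_adj[x' [y' [Rxy]]]|Rxy].
  by case=> -[/gI// [->] /gI// [->]].
by apply/imsetP; exists (x, y); rewrite ?inE.
Qed.

Definition few_common (X Y : finType) (R : X -> Y -> bool) (s t : nat) : Prop :=
  forall xs : 'I_s -> X, injective xs ->
    #|[set y | [forall i, R (xs i) y]]| < t.

Definition bicliques (X Y : finType) (R : X -> Y -> bool) (a b : nat) :
    {set {ffun 'I_a -> X} * {ffun 'I_b -> Y}} :=
  [set f : {ffun 'I_a -> X} * {ffun 'I_b -> Y} |
    [&& injectiveb f.1, injectiveb f.2 & [forall i, forall j, R (f.1 i) (f.2 j)]]].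

Lemma few_common_no_biclique (X Y : finType) (R : X -> Y -> bool) (s t : nat)
    (xs : 'I_s -> X) (ys : 'I_t -> Y) :
  few_common R s t -> injective xs -> injective ys ->
  (forall i j, R (xs i) (ys j)) -> False.
Proof.
move=> few xI yI xyR; have := few _ xI; rewrite ltnNge => /negP; apply.
rewrite -[X in X <= _](card_ord t) -(card_imset _ yI).
apply/subset_leq_card/subsetP => _ /imsetP[j _ ->].
by rewrite inE; apply/forallP => i.
Qed.

(** [K_{s,t}] is connected, so an embedding into a bipartite graph either
    respects the two sides or exchanges them. *)
Lemma bip_graph_embeddings0 (X Y T : finType) (R : X -> Y -> bool) (g : X + Y -> T)
    (gI : injective g) (s t : nat) :
  0 < s -> 0 < t -> few_common R s t -> few_common (fun y x => R x y) s t ->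
  embeddings s t (bip_graph R gI) = set0.
Proof.
case: s t => // s [//|t] _ _ fewX fewY; apply/setP => h; rewrite in_set0.
apply/negP => /embeddingsP[hI hE].
have inlI (i i' : 'I_s.+1) : h (inl i) = h (inl i') -> i = i' by move/hI=> [].
have inrI (j j' : 'I_t.+1) : h (inr j) = h (inr j') -> j = j' by move/hI=> [].
have [x0 [y0 [_ [[hx _]|[hx _]]]]] := bip_adj (hE ord0 ord0).
- have /fin_all_exists[ys hy] j : exists y, h (inr j) = g (inr y).
    have [x [y [_ [[_ ->]|[e _]]]]] := bip_adj (hE ord0 j); first by exists y.
    by move: e; rewrite hx => /gI.
  have /fin_all_exists[xs hxs] i : exists x, h (inl i) = g (inl x).
    have [x [y [_ [[-> _]|[_ e]]]]] := bip_adj (hE i ord0); first by exists x.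
    by move: e; rewrite hy => /gI.
  apply: (few_common_no_biclique fewX (xs := xs) (ys := ys)).
  + by move=> i i' e; apply: inlI; rewrite !hxs e.
  + by move=> j j' e; apply: inrI; rewrite !hy e.
  + by move=> i j; have := hE i j; rewrite hxs hy bip_adjE.
- have /fin_all_exists[ys hy] j : exists x, h (inr j) = g (inl x).
    have [x [y [_ [[e _]|[_ ->]]]]] := bip_adj (hE ord0 j); last by exists x.
    by move: e; rewrite hx => /gI.
  have /fin_all_exists[xs hxs] i : exists y, h (inl i) = g (inr y).
    have [x [y [_ [[_ e]|[-> _]]]]] := bip_adj (hE i ord0); last by exists y.
    by move: e; rewrite hy => /gI.
  apply: (few_common_no_biclique fewY (xs := xs) (ys := ys)).
  + by move=> i i' e; apply: inlI; rewrite !hxs e.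
  + by move=> j j' e; apply: inrI; rewrite !hy e.
  + by move=> i j; have := hE i j; rewrite hxs hy setUC bip_adjE.
Qed.

Lemma card_bicliques_le (X Y T : finType) (R : X -> Y -> bool) (g : X + Y -> T)
    (gI : injective g) (a b : nat) :
  #|bicliques R a b| <= #|embeddings a b (bip_graph R gI)|.
Proof.
pose h (f : {ffun 'I_a -> X} * {ffun 'I_b -> Y}) : {ffun 'I_a + 'I_b -> T} :=
  [ffun z => g (match z with inl i => inl (f.1 i) | inr j => inr (f.2 j) end)].
have hI : injective h.
  move=> [f1 f2] [f1' f2'] /ffunP e; congr (_, _); apply/ffunP => i.
    by have := e (inl i); rewrite !ffunE /= => /gI[].
  by have := e (inr i); rewrite !ffunE /= => /gI[].
rewrite -(card_imset _ hI); apply/subset_leq_card/subsetP => _ /imsetP[f fB ->].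
move: fB; rewrite inE => /and3P[/injectiveP f1 /injectiveP f2 /forallP fR].
apply/embeddingsP; split=> [z z'|i j]; last first.
  by rewrite !ffunE bip_adjE (forallP (fR i)).
by rewrite !ffunE => /gI; case: z z' => [i|j] [i'|j'] // [] => [/f1->|/f2->].
Qed.

Lemma ex_lb (X Y : finType) (R : X -> Y -> bool) (n s t a b : nat) :
  #|X| + #|Y| <= n -> 0 < s -> 0 < t ->
  few_common R s t -> few_common (fun y x => R x y) s t ->
  #|bicliques R a b| <= (a + b) ^ (a + b) * ex n (K a b) (K s t).
Proof.
rewrite -card_sum => len s0 t0 fewX fewY.
pose g (z : X + Y) : 'I_n := widen_ord len (enum_rank z).
have gI : injective g.
  by move=> z z' /(congr1 val)/= /val_inj/enum_rank_inj.
apply: leq_trans (card_bicliques_le _ gI _ _) _.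
apply: leq_trans (card_embeddings_le _ _ _) _; rewrite leq_mul2l; apply/orP; right.
apply: leq_bigmax_cond; rewrite free_embeddings.
by apply/eqP/bip_graph_embeddings0.
Qed.

(** The number [k] is the largest one for which both sides fit into [n] vertices;
    then [n] is less than [2 * p ^ (s * k.+1)], which costs a factor independent of
    [n]. *)
Lemma ex_lb_powers (p s t a b M k0 : nat) :
  1 < p -> 0 < s -> 0 < t ->
  (forall k, k0 <= k -> exists (X Y : finType) (R : X -> Y -> bool),
    [/\ #|X| = (p ^ k) ^ s, #|Y| = (p ^ k) ^ s, few_common R s t,
        few_common (fun y x => R x y) s t &
        (p ^ k) ^ (s * s) <= M * #|bicliques R a b|]) ->
  exists n0, forall n, n0 <= n ->
    n ^ s <= (2 ^ s * p ^ (s * s) * M * (a + b) ^ (a + b)) * ex n (K a b) (K s t).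
Proof.
move=> p1 s0 t0 H; exists ((p ^ s) ^ k0).*2.+2 => n n_ge.
have ps1 : 1 < p ^ s by rewrite -(exp1n s) ltn_exp2r.
have n2 : 0 < n./2 by rewrite half_gt0 (leq_trans _ n_ge).
have /andP[lek gtk] := trunc_log_bounds ps1 n2.
set k := trunc_log (p ^ s) n./2 in lek gtk.
have k0k : k0 <= k.
  apply: trunc_log_max => //; rewrite -[X in X <= _]doubleK half_leq //.
  by rewrite (leq_trans _ n_ge) // ltnW.
have [X [Y [R [cX cY fewX fewY cnt]]]] := H k k0k.
have len : #|X| + #|Y| <= n.
  rewrite cX cY addnn -expnM mulnC expnM; apply: leq_trans (_ : n./2.*2 <= n).
    by rewrite leq_double.
  by rewrite -[X in _ <= X]odd_double_half leq_addl.
have bic := ex_lb a b len s0 t0 fewX fewY.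
have n_le : n <= 2 * (p ^ s) ^ k.+1.
  rewrite -[n]odd_double_half -muln2 mulnC.
  apply: leq_trans (_ : 1 + 2 * n./2 <= _); last first.
    have : 2 * n./2.+1 <= 2 * (p ^ s) ^ k.+1 by rewrite leq_mul2l.
    by apply: leq_trans; rewrite mulnS add1n ltnS; apply: leqnSn.
  by rewrite leq_add2r; case: (odd n).
have : n ^ s <= (2 * (p ^ s) ^ k.+1) ^ s by rewrite leq_exp2r.
move=> /leq_trans; apply.
have -> : (2 * (p ^ s) ^ k.+1) ^ s = 2 ^ s * p ^ (s * s) * (p ^ k) ^ (s * s).
  rewrite expnMn -mulnA; congr (_ * _).
  rewrite -!expnM -expnD; by congr (_ ^ _); rewrite mulnCA mulSn.
rewrite -!mulnA !leq_pmul2l ?expn_gt0 ?(ltnW p1) //.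
apply: leq_trans cnt _; rewrite leq_mul2l; apply/orP; right.
exact: bic.
Qed.

Local Open Scope ring_scope.

(** * Counting tools *)

Lemma card_roots_le (F : finFieldType) (P : {poly F}) (A : {set F}) (m : nat) :
  P != 0 -> (size P <= m.+1)%N -> (forall x, x \in A -> P.[x] = 0) ->
  (#|A| <= m)%N.
Proof.
move=> P0 sP rP; rewrite cardE -ltnS (leq_trans _ sP) //.
apply: max_poly_roots => //; last exact: enum_uniq.
by apply/allP => x; rewrite mem_enum => /rP/eqP.
Qed.

(** A form of the bound on the number of roots in which it is enough to see one
    nonzero coefficient. *)
Lemma card_roots_seq_le (F : finFieldType) (s : seq F) (A : {set F}) :
  has (fun c => c != 0) s -> (forall x, x \in A -> horner_rec s x = 0) ->
  (#|A| <= (size s).-1)%N.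
Proof.
move=> /(has_nthP 0)[i si ci] sA.
have s0 : (0 < size s)%N by apply: leq_ltn_trans si.
apply: (@card_roots_le _ (Poly s)).
- by apply: contraNneq ci => s_eq0; rewrite -coef_Poly s_eq0 coef0.
- by rewrite prednK ?size_Poly.
- by move=> x /sA; rewrite horner_Poly.
Qed.

Lemma card_fibers_le (X Y : finType) (A : {set X}) (B : X -> {set Y}) (m : nat) :
  (forall x, x \in A -> #|B x| <= m)%N ->
  (#|[set xy : X * Y | (xy.1 \in A) && (xy.2 \in B xy.1)]| <= #|A| * m)%N.
Proof.
move=> Bm; rewrite -sum1_card (partition_big fst (mem A)) /=; last first.
  by move=> xy; rewrite inE => /andP[].
rewrite -sum_nat_const; apply: leq_sum => x xA; apply: leq_trans (Bm x xA).
rewrite sum1_card.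
pose C := [set xy : X * Y | [&& xy.1 \in A, xy.2 \in B xy.1 & xy.1 == x]].
rewrite (@eq_card _ _ (mem C)); last first.
  by move=> xy; rewrite unfold_in !inE andbA.
have sndI : {in C &, injective snd}.
  move=> [x1 y1] [x2 y2].
  by rewrite !inE /= => /and3P[_ _ /eqP->] /and3P[_ _ /eqP->] ->.
rewrite -(card_in_imset sndI); apply/subset_leq_card/subsetP.
by move=> _ /imsetP[[x1 y1] + ->]; rewrite inE /= => /and3P[_ + /eqP<-].
Qed.

(** Overwriting a function at the points [x i] forgets only its values there, so
    the functions with prescribed values are at least one in [#|J| ^ #|I|] of
    all. *)
Lemma card_prescribed (X I J : finType) (x : I -> X) (j : I -> J) :
  injective x ->
  (#|{ffun X -> J}| <=
     #|J| ^ #|I| * #|[set g : {ffun X -> J} | [forall i, g (x i) == j i]]|)%N.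
Proof.
move=> xI.
pose ov (h : {ffun X -> J}) : {ffun X -> J} :=
  [ffun z => if [pick i | x i == z] is Some i then j i else h z].
pose D := [set g : {ffun X -> J} | [forall i, g (x i) == j i]].
pose re (h : {ffun X -> J}) : {ffun I -> J} := [ffun i => h (x i)].
have ovI : injective (fun h => (re h, ov h)).
  move=> h h' [/ffunP er /ffunP eo]; apply/ffunP => z; have := eo z.
  rewrite !ffunE; case: pickP => // i /eqP <- _.
  by have := er i; rewrite !ffunE.
rewrite -card_ffun -[#|{ffun I -> J}|]cardsT -cardsX -cardsT -(card_imset _ ovI).
apply/subset_leq_card/subsetP => _ /imsetP[h _ ->]; rewrite !inE /=.
apply/forallP => i; rewrite !ffunE; case: pickP => [i' /eqP/xI -> //|/(_ i)].
by rewrite eqxx.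
Qed.

(** Double counting of the pairs [(t, w)] in relation. *)
Lemma averaging (W T : finType) (S : {set T}) (r : T -> W -> bool) (m : nat) :
  (0 < #|W|)%N -> (forall t, t \in S -> (#|W| <= m * #|[set w | r t w]|)%N) ->
  exists w, (#|S| <= m * #|[set t in S | r t w]|)%N.
Proof.
move=> W0 H.
have [/existsP//|] := boolP [exists w, (#|S| <= m * #|[set t in S | r t w]|)%N].
rewrite negb_exists => /forallP N; exfalso.
have : (\sum_(w in W) m * #|[set t in S | r t w]| < \sum_(w in W) #|S|)%N.
  have /card_gt0P[w0 _] := W0.
  rewrite (bigD1 w0) //= [X in (_ < X)%N](bigD1 w0) //= -addSn leq_add //.
    by rewrite ltnNge N.
  by apply: leq_sum => w _; rewrite ltnW // ltnNge N.
rewrite sum_nat_const ltnNge => /negP; apply.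
rewrite mulnC -sum_nat_const -big_distrr /=.
have -> : (\sum_(w in W) #|[set t in S | r t w]| =
           \sum_(t in S) #|[set w | r t w]|)%N.
  transitivity (\sum_(w in W) \sum_(t in S) (r t w : nat))%N.
    apply: eq_bigr => w _; rewrite -sum1dep_card big_mkcondr /=.
    by apply: eq_bigr => t _; case: (r t w).
  rewrite exchange_big; apply: eq_bigr => t _.
  rewrite -sum1dep_card [RHS]big_mkcond /=.
  by apply: eq_big => w //; case: (r t w).
by rewrite big_distrr; apply: leq_sum => t; apply: H.
Qed.

Lemma expn_le_ffact (q m : nat) : (2 * m <= q)%N -> (q ^ m <= 2 ^ m * q ^_ m)%N.
Proof.
elim: m => // m IH mq; rewrite expnSr ffactnSr expnSr.
have {IH} := IH (leq_trans (leq_mul (leqnn 2) (leqnSn m)) mq).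
have : (q <= 2 * (q - m))%N by lia.
move: (q ^ m)%N (2 ^ m)%N (q ^_ m)%N (q - m)%N => x y z t h1 h2.
by rewrite mulnACA mulnC (mulnC (y * z)%N) leq_mul.
Qed.

(** Squaring identifies [1] and [-1], hence is not onto. *)
Lemma exists_nonsquare (F : finFieldType) :
  (2%:R : F) != 0 -> exists d : F, forall x, x ^+ 2 != d.
Proof.
move=> two0; have [/existsP[d /forallP dP]|] :=
  boolP [exists d : F, [forall x : F, x ^+ 2 != d]]; first by exists d.
rewrite negb_exists => /forallP sq; exfalso.
have im : [set x ^+ 2 | x in [set: F]] = [set: F].
  apply/setP => d; rewrite inE; apply/imsetP.
  by have := sq d; rewrite negb_forall => /existsP[x /negPn/eqP <-]; exists x.
have /imset_injP inj : #|[set x ^+ 2 | x in [set: F]]| == #|[set: F]| by rewrite im.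
have /eqP := inj 1 (-1) (in_setT _) (in_setT _) (esym (sqrrN 1)).
by rewrite -subr_eq0 opprK -[1 + 1]/(2%:R) (negPf two0).
Qed.

(** * The construction for pairs *)

Section PairConstruction.

Variables (F : finFieldType) (p : nat).
Hypothesis pF : p \in [pchar F].

(** Additive, with kernel the prime field. *)
Definition artin_schreier (x : F) : F := x - x ^+ p.
Local Notation pi := artin_schreier.

Lemma artin_schreierD : {morph pi : x y / x + y}.
Proof. by move=> x y; rewrite /pi -!(pFrobenius_autE pF) rmorphD /=; ring. Qed.

Lemma artin_schreier_nat (i : nat) : pi i%:R = 0.
Proof. by rewrite /pi -(pFrobenius_autE pF) pFrobenius_aut_nat subrr. Qed.

Lemma card_artin_schreier_fiber (c : F) : (#|[set x | pi x == c]| <= p)%N.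
Proof.
have p1 := prime_gt1 (pcharf_prime pF).
have sP : size ('X^p - ('X - c%:P) : {poly F}) = p.+1.
  by rewrite size_polyDl ?size_polyXn // size_polyN size_XsubC ltnS.
apply: (@card_roots_le _ ('X^p - ('X - c%:P))); rewrite ?sP //.
  by rewrite -size_poly_eq0 sP.
move=> x; rewrite inE => /eqP <-; rewrite !hornerE /pi; ring.
Qed.

Definition pair_rel (x y : F * F) : bool := x.2 + y.2 == pi (y.1 * x.1).

Lemma pair_rel_sym (x y : F * F) : pair_rel x y = pair_rel y x.
Proof. by rewrite /pair_rel addrC mulrC. Qed.

(** Subtracting the equations of two vertices leaves [pi (u * (v - v'))] with a
    prescribed value. If [v = v'], a common neighbour forces the two vertices to
    coincide. *)
Lemma pair_rel_few : few_common pair_rel 2 p.+1.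
Proof.
move=> xs xI; rewrite ltnS; set S := [set y | _].
pose x0 := xs ord0; pose x1 := xs ord_max.
have SP y : y \in S -> x0.2 + y.2 = pi (y.1 * x0.1) /\ x1.2 + y.2 = pi (y.1 * x1.1).
  by rewrite inE => /forallP H; split; apply/eqP/H.
have x01 : x0 != x1 by apply/eqP => /xI.
case: (eqVneq x0.1 x1.1) => [v01|v01].
  rewrite (_ : S = set0) ?cards0 //; apply/setP => y; rewrite in_set0.
  apply/negP => /SP[e0 e1]; case/eqP: x01.
  rewrite [x0]surjective_pairing [x1]surjective_pairing v01; congr (_, _).
  by apply: (addIr y.2); rewrite e0 e1 v01.
have v0 : x0.1 - x1.1 != 0 by rewrite subr_eq0.
pose h (y : F * F) := y.1 * (x0.1 - x1.1).
have hI : {in S &, injective h}.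
  move=> y y' /SP[e0 _] /SP[e0' _] /(mulIf v0) e.
  rewrite [y]surjective_pairing [y']surjective_pairing e; congr (_, _).
  by apply: (addrI x0.2); rewrite e0 e0' e.
rewrite -(card_in_imset hI).
apply: leq_trans (card_artin_schreier_fiber (x0.2 - x1.2)).
apply/subset_leq_card/subsetP => _ /imsetP[y /SP[e0 e1] ->]; rewrite inE.
apply/eqP; apply: (addIr (pi (y.1 * x1.1))).
by rewrite -artin_schreierD /h -mulrDr subrK -e0 -e1; ring.
Qed.

Lemma nat_inj_pchar (i j : nat) :
  (i < p)%N -> (j < p)%N -> i%:R = j%:R :> F -> i = j.
Proof.
have H (m n : nat) : (m <= n < p)%N -> m%:R = n%:R :> F -> m = n.
  move=> /andP[mn np] e; apply/eqP; rewrite eqn_leq mn -subn_eq0.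
  have: (n - m)%:R == 0 :> F by rewrite natrB // e subrr.
  rewrite -(dvdn_pcharf pF) => /dvdn_leq; case: (n - m)%N (leq_subr m n) => // k kn.
  by move=> /(_ isT) pk; have := leq_ltn_trans (leq_trans pk kn) np; rewrite ltnn.
move=> ip jp e; case: (leqP i j) => ij; first by apply: H; rewrite ?ij.
by apply/esym/H => //; rewrite (ltnW ij).
Qed.

(** The product of [u + j / beta] and [v + beta * i] has the cross term [j * i],
    which [pi] kills; the other three terms depend on [i] only or on [j] only and
    are absorbed by the second coordinates. The vertices of index [0] and [1]
    determine the parameters. *)
Lemma card_pair_bicliques (a b : nat) :
  (1 < a)%N -> (0 < b)%N -> (a <= p)%N -> (b <= p)%N ->
  (#|F| ^ 3 * #|F|.-1 <= #|bicliques pair_rel a b|)%N.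
Proof.
move=> a1 b0 ap bp.
pose xs (th : (F * F * F) * F) : {ffun 'I_a -> F * F} :=
  let: (v, u, A, beta) := th in
  [ffun i : 'I_a => (v + beta * i%:R, A + pi (u * v) + pi (u * (beta * i%:R)))].
pose ys (th : (F * F * F) * F) : {ffun 'I_b -> F * F} :=
  let: (v, u, A, beta) := th in
  [ffun j : 'I_b => (u + j%:R / beta, pi (j%:R / beta * v) - A)].
pose D := setX [set: F * F * F] [set~ (0 : F)].
have cD : #|D| = (#|F| ^ 3 * #|F|.-1)%N.
  by rewrite cardsX cardsT !card_prod cardsC1 !expnSr expn0 mul1n.
have xyI : {in D &, injective (fun th => (xs th, ys th))}.
  move=> [[[v u] A] be] [[[v' u'] A'] be']; rewrite !inE /= => be0 be0' [ex ey].
  have i0 := ltnW a1.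
  have /ffunP/(_ (Ordinal i0)) := ex; rewrite !ffunE /= !mulr0 !addr0 => -[ev _].
  have /ffunP/(_ (Ordinal a1)) := ex.
  rewrite !ffunE /= !mulr1 ev => -[/addrI eb _].
  have /ffunP/(_ (Ordinal b0)) := ey.
  rewrite !ffunE /= !mul0r !addr0 => -[eu /addrI/oppr_inj eA].
  by rewrite eb eu eA.
rewrite -cD -(card_in_imset xyI); apply/subset_leq_card/subsetP.
move=> f /imsetP[[[[v u] A] be] thD ->]; have {thD} be0 : be != 0.
  by move: thD; rewrite !inE.
rewrite inE /=.
apply/and3P; split.
- apply/injectiveP => i i'; rewrite !ffunE => -[/addrI/(mulfI be0) e _].
  apply/val_inj/nat_inj_pchar => //; [exact: leq_trans (ltn_ord i) ap|].
  exact: leq_trans (ltn_ord i') ap.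
- apply/injectiveP => j j'; rewrite !ffunE => -[/addrI e _].
  have be0' : be^-1 != 0 by rewrite invr_eq0.
  move/(mulIf be0'): e => e.
  apply/val_inj/nat_inj_pchar => //; [exact: leq_trans (ltn_ord j) bp|].
  exact: leq_trans (ltn_ord j') bp.
apply/forallP => i; apply/forallP => j; rewrite /pair_rel !ffunE /=.
have -> : (u + j%:R / be) * (v + be * i%:R) =
    u * v + u * (be * i%:R) + j%:R / be * v + (j * i)%:R :> F.
  by rewrite natrM; field.
by rewrite !artin_schreierD artin_schreier_nat; apply/eqP; ring.
Qed.

End PairConstruction.

(** * The construction for triples *)

Section TripleConstruction.

Variables (F : finFieldType) (d : F).
Hypothesis two_neq0 : (2%:R : F) != 0.
Hypothesis d_nonsquare : forall x : F, x ^+ 2 != d.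

(** The norm form of the quadratic extension by a square root of [d]. *)
Definition qnorm (z : F * F) : F := z.1 ^+ 2 - d * z.2 ^+ 2.

(** Nonconstant of degree at most 2 in each variable. As polynomials in [u], with
    coefficients [v + 1], [v^2] and [v^2], the values at different [v] differ in the
    coefficient of [u^2], and the points [(v + 1, v^2)] lie on a parabola, so that
    no three of them are collinear. *)
Definition twist (u v : F) : F := u ^+ 2 * v + u * v ^+ 2 + u ^+ 2 + v ^+ 2.

Lemma d_neq0 : d != 0.
Proof. by have := d_nonsquare 0; rewrite expr0n /= eq_sym. Qed.

Lemma twistC (u v : F) : twist u v = twist v u.
Proof. by rewrite /twist; ring. Qed.

Lemma sub_sqr_eq0 (x y : F) : (x ^+ 2 - d * y ^+ 2 == 0) = (x == 0) && (y == 0).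
Proof.
apply/idP/andP => [|[/eqP-> /eqP->]]; last by rewrite !expr0n /= mulr0 subr0.
rewrite subr_eq0 => /eqP e; case: (eqVneq y 0) e => [->|y0] e.
  by rewrite expr0n /= mulr0 in e; split=> //; rewrite -sqrf_eq0 e.
by case/negP: (d_nonsquare (x / y)); rewrite expr_div_n e mulfK ?sqrf_eq0.
Qed.

(** Subtracting the first equation from the other two leaves two equations linear
    in the point [y.1] of the plane, with right-hand sides [h2] and [h3] quadratic
    in the scalar [u] of [y]. In orthogonal coordinates centred at [- z1], with [p]
    along [z2 - z1] and [w] across it, they read [2 * p = h2 u] and
    [s * h2 u + r * w = h3 u], where [r] vanishes exactly when the three points are
    collinear; the first equation becomes
    [p^2 - d * w^2 = n2 * (twist u v1 + g1)].
    If [r != 0], both coordinates are polynomials in [u], and [u] is a root of a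
    nonzero polynomial of degree at most 4. If [r = 0], then [u] is a root of the
    nonzero polynomial [s * h2 - h3] of degree at most 2, and for each [u] the
    coordinate [w] is one of two square roots. *)
Lemma card_common_nbrs_le4 (z1 z2 z3 : F * F) (v1 v2 v3 g1 g2 g3 : F)
    (S : {set (F * F) * F}) :
  z2 != z1 -> (z3, v3) != (z1, v1) -> (z3, v3) != (z2, v2) ->
  (v2 = v1 -> g2 = g1) -> (v3 = v1 -> g3 = g1) ->
  (forall y, y \in S ->
    [/\ qnorm (z1 + y.1) = twist y.2 v1 + g1, qnorm (z2 + y.1) = twist y.2 v2 + g2
      & qnorm (z3 + y.1) = twist y.2 v3 + g3]) ->
  (#|S| <= 4)%N.
Proof.
move=> z21 p31 p32 g21 g31 HS.
pose a := z2.1 - z1.1; pose b := z2.2 - z1.2.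
pose a' := z3.1 - z1.1; pose b' := z3.2 - z1.2.
pose n2 := a ^+ 2 - d * b ^+ 2; pose n3 := a' ^+ 2 - d * b' ^+ 2.
have n20 : n2 != 0.
  rewrite sub_sqr_eq0 !subr_eq0; apply: contraNN z21.
  by rewrite -xpair_eqE -!surjective_pairing.
pose s := (a' * a - d * b' * b) / n2.
pose D := a * b' - a' * b.
pose r := 2%:R * d * D / n2.
pose h2 u := twist u v2 - twist u v1 + (g2 - g1) - n2.
pose h3 u := twist u v3 - twist u v1 + (g3 - g1) - n3.
pose w (y : (F * F) * F) := b * (z1.1 + y.1.1) - a * (z1.2 + y.1.2).
pose p (y : (F * F) * F) := a * (z1.1 + y.1.1) - d * b * (z1.2 + y.1.2).
have E2 y : y \in S -> 2%:R * p y = h2 y.2.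
  case/HS => e1 e2 _.
  have -> : h2 y.2 = (twist y.2 v2 + g2) - (twist y.2 v1 + g1) - n2 by rewrite /h2; ring.
  rewrite -e1 -e2 /qnorm /p /n2 /a /b /=; set X := z1.1; set Y := z1.2; ring.
have E3 y : y \in S -> s * h2 y.2 + r * w y = h3 y.2.
  move=> yS; rewrite -E2 //; have [e1 _ e3] := HS _ yS.
  have -> : h3 y.2 = (twist y.2 v3 + g3) - (twist y.2 v1 + g1) - n3 by rewrite /h3; ring.
  transitivity (2%:R * (a' * (z1.1 + y.1.1) - d * b' * (z1.2 + y.1.2))).
    apply: (mulIf n20); rewrite mulrDl (mulrAC s) (mulrAC r) !(divfK n20).
    by rewrite /p /w /D /n2; ring.
  rewrite -e1 -e3 /qnorm /n3 /a' /b' /=; set X := z1.1; set Y := z1.2; ring.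
have E1 y : y \in S ->
    h2 y.2 ^+ 2 - 4%:R * (d * w y ^+ 2) = 4%:R * (n2 * (twist y.2 v1 + g1)).
  move=> yS; rewrite -E2 //; have [<- _ _] := HS _ yS.
  by rewrite /qnorm /n2 /p /w /=; ring.
have inj y y' : y \in S -> y' \in S -> y.2 = y'.2 -> w y = w y' -> y = y'.
  move=> yS yS' e2 ew.
  have ep : p y = p y' by apply: (mulfI two_neq0); rewrite !E2 // e2.
  have eX x : n2 * (z1.1 + x.1.1) = a * p x - d * b * w x by rewrite /n2 /p /w; ring.
  have eY x : n2 * (z1.2 + x.1.2) = b * p x - a * w x by rewrite /n2 /p /w; ring.
  have /(mulfI n20)/addrI e11 : n2 * (z1.1 + y.1.1) = n2 * (z1.1 + y'.1.1).
    by rewrite !eX ep ew.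
  have /(mulfI n20)/addrI e12 : n2 * (z1.2 + y.1.2) = n2 * (z1.2 + y'.1.2).
    by rewrite !eY ep ew.
  by move: y y' e2 e11 e12 {yS yS' ew ep} => [[? ?] ?] [[? ?] ?] /= -> -> ->.
have four0 : 4%:R != 0 :> F by rewrite (natrM _ 2 2) mulf_neq0.
pose A2 := v2 - v1; pose B2 := v2 ^+ 2 - v1 ^+ 2.
pose C2 := v2 ^+ 2 - v1 ^+ 2 + (g2 - g1) - n2.
pose A3 := v3 - v1; pose B3 := v3 ^+ 2 - v1 ^+ 2.
pose C3 := v3 ^+ 2 - v1 ^+ 2 + (g3 - g1) - n3.
have h2E u : h2 u = A2 * u ^+ 2 + B2 * u + C2.
  by rewrite /h2 /twist /A2 /B2 /C2; ring.
have h3E u : h3 u = A3 * u ^+ 2 + B3 * u + C3.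
  by rewrite /h3 /twist /A3 /B3 /C3; ring.
have [r0|r0] := eqVneq r 0.
  have D0 : D = 0.
    apply/eqP; move/eqP: r0; rewrite /r mulf_eq0 invr_eq0 (negPf n20) orbF.
    by rewrite !mulf_eq0 (negPf two_neq0) (negPf d_neq0).
  have a'E : a' = s * a.
    apply: (mulIf n20); rewrite mulrAC (divfK n20) /n2.
    transitivity ((a' * a - d * b' * b) * a + d * b * D); first by rewrite /D; ring.
    by rewrite D0 mulr0 addr0.
  have b'E : b' = s * b.
    apply: (mulIf n20); rewrite mulrAC (divfK n20) /n2.
    transitivity ((a' * a - d * b' * b) * b + a * D); first by rewrite /D; ring.
    by rewrite D0 mulr0 addr0.
  clearbody s.
  pose U := [set u | s * h2 u == h3 u].
  pose W u := [set x |
    h2 u ^+ 2 - 4%:R * (d * x ^+ 2) == 4%:R * (n2 * (twist u v1 + g1))].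
  have cU : (#|U| <= 2)%N.
    apply: (@card_roots_seq_le _ [:: s * C2 - C3; s * B2 - B3; s * A2 - A3]); last first.
      clearbody A2 B2 C2 A3 B3 C3.
      move=> u; rewrite inE h2E h3E /= -subr_eq0 => /eqP e; rewrite -[RHS]e. ring.
    rewrite /= orbF; apply/negPn/negP; rewrite !negb_or !negbK !subr_eq0.
    move=> /and3P[/eqP eC /eqP eB /eqP eA].
    have s0F : s = 0 -> v3 = v1 -> False.
      move=> s0 v31; move/negP: p31; apply; rewrite v31 xpair_eqE eqxx andbT.
      rewrite [z3]surjective_pairing [z1]surjective_pairing xpair_eqE.
      by rewrite -(subr_eq0 z3.1) -(subr_eq0 z3.2) -/a' -/b' a'E b'E s0 !mul0r eqxx.
    have s1F : s = 1 -> v3 = v2 -> False.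
      move=> s1 v32; move/negP: p32; apply; rewrite v32 xpair_eqE eqxx andbT.
      rewrite [z3]surjective_pairing [z2]surjective_pairing xpair_eqE.
      rewrite s1 !mul1r in a'E b'E.
      apply/andP; split; apply/eqP; first exact: (addIr (- z1.1)).
      exact: (addIr (- z1.2)).
    (* With equal scalars the constants agree too, and only [s * (1 - s) * n2] is
       left of the polynomial; it vanishes only if [z3] is [z1] or [z2]. *)
    have same : v2 = v1 -> v3 = v1 -> False.
      move=> v21 v31; have : s * (1 - s) * n2 = 0.
        transitivity (C3 - s * C2); last by rewrite eC subrr.
        rewrite /C2 /C3 v21 v31 g21 // g31 // /n3 a'E b'E /n2; ring.
      move/eqP; rewrite !mulf_eq0 (negPf n20) orbF subr_eq0 => /orP[/eqP s0|/eqP s1].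
        exact: s0F.
      exact: s1F (esym s1) (etrans v31 (esym v21)).
    have : A3 * (v2 - v3) = 0.
      transitivity (s * B2 - B3); last by rewrite eB subrr.
      have -> : s * B2 = s * A2 * (v2 + v1) by rewrite /B2 /A2; ring.
      by rewrite eA /A3 /B3; ring.
    move/eqP; rewrite mulf_eq0 !subr_eq0 => /orP[/eqP v31|/eqP v23].
      move/eqP: eA; rewrite /A3 v31 subrr mulf_eq0 subr_eq0.
      by case/orP => /eqP; [move/s0F; apply | move/same; apply].
    have : (s - 1) * A2 = 0.
      by rewrite mulrBl mul1r eA /A3 /A2 v23 subrr.
    move/eqP; rewrite mulf_eq0 !subr_eq0 => /orP[/eqP s1|/eqP v21].
      exact: s1F s1 (esym v23).
    exact: same v21 (etrans (esym v23) v21).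
  have cW u : u \in U -> (#|W u| <= 2)%N.
    move=> _; apply: (@card_roots_seq_le _
       [:: h2 u ^+ 2 - 4%:R * (n2 * (twist u v1 + g1)); 0; - (4%:R * d)]).
      by rewrite /= oppr_eq0 mulf_eq0 (negPf four0) (negPf d_neq0) !orbT.
    by move=> x; rewrite inE /= -subr_eq0 => /eqP e; rewrite -[RHS]e; ring.
  have injS : {in S &, injective (fun y => (y.2, w y))}.
    by move=> y y' yS yS' [e e']; apply: inj.
  rewrite -(card_in_imset injS).
  apply: leq_trans (leq_trans (card_fibers_le cW) _); last first.
    by rewrite -[4%N]/(2 * 2)%N leq_mul2r.
  apply/subset_leq_card/subsetP => _ /imsetP[y yS ->]; rewrite !inE /= E1 // eqxx.
  by rewrite andbT -(E3 y) // r0 mul0r addr0.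
clearbody r s.
have injS : {in S &, injective (fun y => y.2)}.
  move=> y y' yS yS' e; apply: inj => //; apply: (mulfI r0).
  by apply: (addrI (s * h2 y.2)); rewrite E3 // e E3.
rewrite -(card_in_imset injS).
pose A := A3 - s * A2; pose B := B3 - s * B2; pose C := C3 - s * C2.
apply: (@card_roots_seq_le _
  [:: r ^+ 2 * C2 ^+ 2 - 4%:R * (d * C ^+ 2) - 4%:R * (n2 * r ^+ 2 * (v1 ^+ 2 + g1));
   2%:R * r ^+ 2 * B2 * C2 - 8%:R * d * B * C - 4%:R * (n2 * r ^+ 2 * v1 ^+ 2);
   r ^+ 2 * (B2 ^+ 2 + 2%:R * A2 * C2) - 4%:R * (d * (B ^+ 2 + 2%:R * A * C))
     - 4%:R * (n2 * r ^+ 2 * (v1 + 1));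
   2%:R * r ^+ 2 * A2 * B2 - 8%:R * d * A * B;
   (r * A2) ^+ 2 - d * (2%:R * A) ^+ 2]).
  (* The coefficient of [u^4] is an anisotropic form: if it vanishes, then all three
     scalars agree, and the terms in [u^2] and [u] are proportional to those of
     [twist u v1]. *)
  apply/negPn/negP; rewrite /= orbF !negb_or !negbK.
  move=> /and5P[_ /eqP c1 /eqP c2 _]; rewrite sub_sqr_eq0 !mulf_eq0 (negPf r0).
  rewrite (negPf two_neq0) /= => /andP[/eqP A20 /eqP A0].
  have A30 : A3 = 0 by move: A0; rewrite /A A20 mulr0 subr0.
  have B20 : B2 = 0 by rewrite /B2 subr_sqr -/A2 A20 mul0r.
  have B30 : B3 = 0 by rewrite /B3 subr_sqr -/A3 A30 mul0r.
  have B0 : B = 0 by rewrite /B B20 B30 mulr0 subr0.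
  move/eqP: c1; rewrite B0 B20 !(mulr0, mul0r, subr0) sub0r oppr_eq0.
  have nr0 : n2 * r ^+ 2 != 0 by rewrite mulf_neq0 ?expf_neq0.
  rewrite mulf_eq0 (negPf four0) mulf_eq0 (negPf nr0) /= sqrf_eq0 => /eqP v10.
  move/eqP: c2; rewrite B0 B20 A20 A0 !(mulr0, mul0r, expr0n, addr0, subr0) /=.
  by rewrite sub0r oppr_eq0 v10 add0r mulr1 mulf_eq0 (negPf four0) (negPf nr0).
move=> _ /imsetP[y yS ->] /=.
have e1 := E1 y yS; have e3 := E3 y yS; move: e1 e3.
move: (y.2) (w y) => u x e1 e3.
have rx : r * x = A * u ^+ 2 + B * u + C.
  by apply: (addrI (s * h2 u)); rewrite e3 h2E h3E /A /B /C; ring.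
have : r ^+ 2 * h2 u ^+ 2 - 4%:R * (d * (r * x) ^+ 2)
     - r ^+ 2 * (4%:R * (n2 * (twist u v1 + g1))) = 0 by rewrite -e1; ring.
rewrite rx h2E /twist => e; rewrite -[RHS]e; clearbody A B C A2 B2 C2 n2.
ring.
Qed.

(** The data of one side of the graph: the values of the additive constants, the
    colouring of the scalars, and the colouring of the points of the plane. *)
Definition palette (m : nat) : finType :=
  ({ffun 'I_m -> F} * {ffun F -> 'I_m} * {ffun F * F -> 'I_m})%type.

Definition shift_of (m : nat) (w : palette m) (v : F) : F := w.1.1 (w.1.2 v).

Definition coherent (m : nat) (w : palette m) (x : (F * F) * F) : bool :=
  w.2 x.1 == w.1.2 x.2.

(** The summand attached to a vertex depends on its colour only; coherence makes
    that colour readable both from the scalar and from the point. *)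
Definition triple_rel (a b : nat) (w : palette a) (w' : palette b)
    (x y : (F * F) * F) : bool :=
  [&& coherent w x, coherent w' y &
    qnorm (x.1 + y.1) == twist y.2 x.2 + (shift_of w x.2 + shift_of w' y.2)].

Lemma triple_relC (a b : nat) (w : palette a) (w' : palette b) (x y : (F * F) * F) :
  triple_rel w w' x y = triple_rel w' w y x.
Proof.
rewrite /triple_rel andbCA twistC [y.1 + _]addrC.
by rewrite [shift_of w' _ + _]addrC.
Qed.

(** Equal values at distinct [v] and [v0] force [u^2 + (u + 1) * (v + v0) = 0]; two such
    equations give [u = -1], and then [u^2 = 0]. *)
Lemma twist_inj3 (u v0 v1 v2 : F) :
  v0 != v1 -> v0 != v2 -> v1 != v2 ->
  twist u v1 = twist u v0 -> twist u v2 = twist u v0 -> False.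
Proof.
move=> v01 v02 v12 e1 e2.
have H v : v0 != v -> twist u v = twist u v0 -> u ^+ 2 + (u + 1) * (v + v0) = 0.
  move=> v0v e; have : (v - v0) * (u ^+ 2 + (u + 1) * (v + v0)) = 0.
    by transitivity (twist u v - twist u v0); [rewrite /twist; ring | rewrite e subrr].
  by move/eqP; rewrite mulf_eq0 subr_eq0 eq_sym (negPf v0v) => /eqP.
have {e1}H1 := H _ v01 e1; have {e2}H2 := H _ v02 e2.
have : (u + 1) * (v1 - v2) = 0.
  by transitivity ((u ^+ 2 + (u + 1) * (v1 + v0)) - (u ^+ 2 + (u + 1) * (v2 + v0)));
    [ring | rewrite H1 H2 subrr].
move/eqP; rewrite mulf_eq0 [v1 - _ == _]subr_eq0 (negPf v12) orbF => /eqP u1.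
move/eqP: H1; rewrite u1 mul0r addr0 sqrf_eq0 => /eqP u0.
by move/eqP: u1; rewrite u0 add0r oner_eq0.
Qed.

(** The common neighbours [(w, u)] are sorted by the colour of [u], which makes
    the additive constants independent of [u]. Within a colour, coherence enters
    twice: vertices with the same scalar have the same constant, as
    [card_common_nbrs_le4] demands, and three vertices with the same point have the
    same constant too, so that [twist_inj3] excludes a common neighbour. *)
Lemma triple_rel_few (a b : nat) (w : palette a) (w' : palette b) :
  few_common (triple_rel w w') 3 (b * 4).+1.
Proof.
move=> xs xI; rewrite ltnS; set S := [set y | _].
pose x0 := xs (@Ordinal 3 0 isT); pose x1 := xs (@Ordinal 3 1 isT).
pose x2 := xs (@Ordinal 3 2 isT).
have x01 : x0 != x1 by apply/eqP => /xI.
have x02 : x0 != x2 by apply/eqP => /xI.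
have x12 : x1 != x2 by apply/eqP => /xI.
have SP y : y \in S ->
  [/\ triple_rel w w' x0 y, triple_rel w w' x1 y & triple_rel w w' x2 y].
  by rewrite inE => /forallP H; split; apply: H.
rewrite -sum1_card (partition_big (fun y : (F * F) * F => w'.1.2 y.2) xpredT) //=.
rewrite -[X in (_ <= X * _)%N](card_ord b) -sum_nat_const; apply: leq_sum => j _.
rewrite sum1_card.
pose Sj := [set y | (y \in S) && (w'.1.2 y.2 == j)].
rewrite (@eq_card _ _ (mem Sj)); last by move=> y; rewrite unfold_in [RHS]inE.
have [->|[y]] := set_0Vmem Sj; first by rewrite cards0.
rewrite inE => /andP[/SP[/and3P[/eqP c0 _ /eqP e0] /and3P[/eqP c1 _ /eqP e1]
  /and3P[/eqP c2 _ /eqP e2]] _].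
have sh x x' : w.2 x.1 = w.1.2 x.2 -> w.2 x'.1 = w.1.2 x'.2 -> x.1 = x'.1 ->
    shift_of w x.2 = shift_of w x'.2.
  by move=> cx cx' e; rewrite /shift_of -cx -cx' e.
have E y' : y' \in Sj -> [/\
    qnorm (x0.1 + y'.1) = twist y'.2 x0.2 + (shift_of w x0.2 + w'.1.1 j),
    qnorm (x1.1 + y'.1) = twist y'.2 x1.2 + (shift_of w x1.2 + w'.1.1 j) &
    qnorm (x2.1 + y'.1) = twist y'.2 x2.2 + (shift_of w x2.2 + w'.1.1 j)].
  rewrite inE => /andP[/SP[/and3P[_ _ /eqP f0] /and3P[_ _ /eqP f1]
    /and3P[_ _ /eqP f2]] /eqP <-]; by split.
have pr x x' : x != x' -> (x.1, x.2) != (x'.1, x'.2) :> (F * F) * F.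
  by rewrite -!surjective_pairing.
(* The lemma on four common neighbours asks for a second point different from the
   first; unless all three points agree, one of two orders of the vertices works. *)
have [z10|z10] := eqVneq x1.1 x0.1; last first.
  apply: (@card_common_nbrs_le4 x0.1 x1.1 x2.1 x0.2 x1.2 x2.2
    (shift_of w x0.2 + w'.1.1 j) (shift_of w x1.2 + w'.1.1 j)
    (shift_of w x2.2 + w'.1.1 j)) => //.
  - by apply: pr; rewrite eq_sym.
  - by apply: pr; rewrite eq_sym.
  - by move=> ->.
  - by move=> ->.
have [z20|z20] := eqVneq x2.1 x0.1; last first.
  apply: (@card_common_nbrs_le4 x0.1 x2.1 x1.1 x0.2 x2.2 x1.2
    (shift_of w x0.2 + w'.1.1 j) (shift_of w x2.2 + w'.1.1 j)
    (shift_of w x1.2 + w'.1.1 j)) => //.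
  - by apply: pr; rewrite eq_sym.
  - by move=> ->.
  - by move=> ->.
  - by move=> y' /E[].
have vne x x' : x != x' -> x.1 = x'.1 -> x.2 != x'.2.
  move=> ne e; apply: contraNneq ne => e'.
  by rewrite [x]surjective_pairing [x']surjective_pairing e e'.
exfalso; apply: (@twist_inj3 y.2 x0.2 x1.2 x2.2).
- exact: vne.
- exact: vne.
- by apply: vne => //; rewrite z10.
- apply: (addIr (shift_of w x0.2 + shift_of w' y.2)).
  by rewrite -e0 -z10 -{1}(sh _ _ c1 c0 z10) e1.
- apply: (addIr (shift_of w x0.2 + shift_of w' y.2)).
  by rewrite -e0 -z20 -{1}(sh _ _ c2 c0 z20) e2.
Qed.

(** The index of a vertex of the future copy serves as its colour. *)
Definition fits (m : nat) (c v : 'I_m -> F) (z : 'I_m -> F * F) (w : palette m) :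
    bool :=
  [&& [forall i, w.1.1 i == c i], [forall i, w.1.2 (v i) == i] &
    [forall i, w.2 (z i) == i]].

Definition palette_cost (m : nat) : nat := (#|F| ^ m * m ^ m * m ^ m)%N.

Lemma card_fits (m : nat) (c v : 'I_m -> F) (z : 'I_m -> F * F) :
  injective v -> injective z ->
  (#|palette m| <= palette_cost m * #|[set w | fits c v z w]|)%N.
Proof.
move=> vI zI.
rewrite (_ : [set w | _] =
  setX (setX [set g : {ffun 'I_m -> F} | [forall i, g i == c i]]
             [set g : {ffun F -> 'I_m} | [forall i, g (v i) == i]])
       [set g : {ffun F * F -> 'I_m} | [forall i, g (z i) == i]]); last first.
  by apply/setP => w; rewrite !inE /fits andbA.
have h1 := card_prescribed c (@inj_id 'I_m).
have h2 := card_prescribed (fun i => i) vI.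
have h3 := card_prescribed (fun i => i) zI.
rewrite !card_ord in h1 h2 h3.
rewrite !cardsX /palette !card_prod /palette_cost.
apply: leq_trans (leq_mul (leq_mul h1 h2) h3) _.
by rewrite [X in (X * _ <= _)%N]mulnACA mulnACA.
Qed.

Definition quad (c0 c1 c2 v : F) : F := c0 + c1 * v + c2 * v ^+ 2.

Lemma quad_eq3 (m : nat) (v : 'I_m -> F) (c0 c1 c2 e0 e1 e2 : F) :
  (2 < m)%N -> injective v ->
  (forall i, quad c0 c1 c2 (v i) = quad e0 e1 e2 (v i)) ->
  [/\ c0 = e0, c1 = e1 & c2 = e2].
Proof.
move=> m2 vI H.
have [nz|N] := boolP (has (fun c => c != 0) [:: c0 - e0; c1 - e1; c2 - e2]).
  have : (#|v @: [set: 'I_m]| <= 2)%N.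
    apply: (@card_roots_seq_le _ [:: c0 - e0; c1 - e1; c2 - e2]) => //.
    move=> x /imsetP[i _ ->] /=.
    by transitivity (quad c0 c1 c2 (v i) - quad e0 e1 e2 (v i));
      [rewrite /quad; ring | rewrite H subrr].
  by rewrite card_imset // cardsT card_ord leqNgt m2.
move: N; rewrite /= orbF !negb_or !negbK !subr_eq0.
by case/and3P => /eqP-> /eqP-> /eqP->.
Qed.

(** The nine parameters of a copy, as
    [((al0, al2, al1), (be0, be1, de), (g0, g1, g2))]. The left points run along the
    curve with coordinates [al0 + al1 v + al2 v^2] and [be0 + be1 v + be2 v^2];
    in place of [be2] the tuple holds the determinant [de = al1 be2 - al2 be1], whose
    nonvanishing says that the velocity vectors [(al1, be1)] and [(al2, be2)] are
    independent. With [al1 != 0], which allows [be2] to be recovered, this makes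
    [good_params] a product set. *)
Definition param : finType :=
  ((F * F * F) * (F * F * F) * (F * F * F))%type.

Definition left_center (p : param) (v : F) : F * F :=
  let: ((al0, al2, al1), (be0, be1, de), _) := p in
  (quad al0 al1 al2 v, quad be0 be1 ((al2 * be1 + de) / al1) v).

Definition left_shift (p : param) (v : F) : F :=
  let: (_, _, (g0, g1, g2)) := p in
  qnorm (left_center p v) + quad g0 g1 g2 v - v ^+ 2.

(** The solution [w] of the two linear equations, for the bilinear form of
    [qnorm], that equate the coefficients of [v] and of [v^2] in [center_eq]:
    twice the products of [w] with the two velocity vectors are [u^2 + g1] and
    [u + g2]. The constant coefficient then dictates [right_shift]. *)
Definition right_center (p : param) (u : F) : F * F :=
  let: ((al0, al2, al1), (be0, be1, de), (g0, g1, g2)) := p in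
  (((al2 * be1 + de) / al1 * (u ^+ 2 + g1) - be1 * (u + g2)) / (2%:R * de),
   (al2 * (u ^+ 2 + g1) - al1 * (u + g2)) / (2%:R * d * de)).

Definition right_shift (p : param) (u : F) : F :=
  let: ((al0, al2, al1), (be0, be1, de), (g0, g1, g2)) := p in
  qnorm (right_center p u)
    + 2%:R * (al0 * (right_center p u).1 - d * be0 * (right_center p u).2)
    - u ^+ 2 - g0.

Definition good_params : {set param} :=
  setX (setX (setX [set: F * F] [set~ 0]) (setX [set: F * F] [set~ 0]))
    [set: F * F * F].

Lemma good_paramsE al0 al2 al1 be0 be1 de g0 g1 g2 :
  (((al0, al2, al1), (be0, be1, de), (g0, g1, g2)) : param) \in good_params =
  (al1 != 0) && (de != 0).
Proof. by rewrite !inE /= andbT. Qed.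

Lemma center_eq (p : param) (u v : F) : p \in good_params ->
  qnorm (left_center p v + right_center p u) =
    twist u v + (left_shift p v + right_shift p u).
Proof.
case: p => [[[[al0 al2] al1] [[be0 be1] de]] [[g0 g1] g2]].
rewrite good_paramsE => /andP[al10 de0].
have d0 := d_neq0.
rewrite /left_shift /right_shift /left_center /right_center /qnorm /twist /quad /=.
by field; rewrite al10 de0 d0 two_neq0.
Qed.

(** The velocity vectors are independent, hence the curve is an affine image of
    the parabola. *)
Lemma left_center_inj (p : param) : p \in good_params -> injective (left_center p).
Proof.
case: p => [[[[al0 al2] al1] [[be0 be1] de]] [[g0 g1] g2]].
rewrite good_paramsE => /andP[al10 de0] v v' [e1 e2].
set be2 := (al2 * be1 + de) / al1 in e2.
have deE : de = al1 * be2 - al2 * be1 by rewrite [al1 * _]mulrC divfK // addrC addKr.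
apply/eqP; rewrite -subr_eq0.
have : de * (v - v') = 0.
  transitivity ((be2 * (quad al0 al1 al2 v - quad al0 al1 al2 v'))
    - al2 * (quad be0 be1 be2 v - quad be0 be1 be2 v')).
    by rewrite deE /quad; clearbody be2; ring.
  by rewrite e1 e2 !subrr !mulr0 subrr.
by move/eqP; rewrite mulf_eq0 (negPf de0).
Qed.

(** The scalar [u] is recovered from the product with the second velocity
    vector. *)
Lemma right_center_inj (p : param) : p \in good_params -> injective (right_center p).
Proof.
case: p => [[[[al0 al2] al1] [[be0 be1] de]] [[g0 g1] g2]].
rewrite good_paramsE => /andP[al10 de0] u u' [e1 e2].
have d0 := d_neq0.
have H x : x = 2%:R * (al2 *
    (((al2 * be1 + de) / al1 * (x ^+ 2 + g1) - be1 * (x + g2)) / (2%:R * de))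
  - d * ((al2 * be1 + de) / al1) *
    ((al2 * (x ^+ 2 + g1) - al1 * (x + g2)) / (2%:R * d * de))) - g2.
  by field; rewrite al10 de0 d0 two_neq0.
by rewrite [u]H [u']H e1 e2.
Qed.

Definition xs_of (a : nat) (p : param) (v : {ffun 'I_a -> F}) :
    {ffun 'I_a -> (F * F) * F} := [ffun i => (left_center p (v i), v i)].

Definition ys_of (b : nat) (p : param) (u : {ffun 'I_b -> F}) :
    {ffun 'I_b -> (F * F) * F} := [ffun j => (right_center p (u j), u j)].

Definition fits_left (a : nat) (p : param) (v : {ffun 'I_a -> F}) :
    palette a -> bool :=
  fits (fun i => left_shift p (v i)) v (fun i => left_center p (v i)).

Definition fits_right (b : nat) (p : param) (u : {ffun 'I_b -> F}) :
    palette b -> bool :=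
  fits (fun j => right_shift p (u j)) u (fun j => right_center p (u j)).

Lemma fits_biclique (a b : nat) (p : param) (v : {ffun 'I_a -> F})
    (u : {ffun 'I_b -> F}) (w : palette a) (w' : palette b) :
  p \in good_params -> injective v -> injective u ->
  fits_left p v w -> fits_right p u w' ->
  (xs_of p v, ys_of p u) \in bicliques (triple_rel w w') a b.
Proof.
move=> pg vI uI /and3P[/forallP wc /forallP wv /forallP wz].
move=> /and3P[/forallP wc' /forallP wv' /forallP wz'].
rewrite inE; apply/and3P; split.
- by apply/injectiveP => i i'; rewrite !ffunE => -[_ /vI].
- by apply/injectiveP => j j'; rewrite !ffunE => -[_ /uI].
apply/forallP => i; apply/forallP => j; rewrite !ffunE; apply/and3P; split.
- by rewrite /coherent /= (eqP (wz i)) (eqP (wv i)).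
- by rewrite /coherent /= (eqP (wz' j)) (eqP (wv' j)).
rewrite /= center_eq // /shift_of (eqP (wv i)) (eqP (wv' j)).
by rewrite (eqP (wc i)) (eqP (wc' j)).
Qed.

(** Three of the vertices determine the quadratic curve, and their additive
    constants the quadratic function of [left_shift]. *)
Lemma xs_of_inj (a : nat) (p p' : param) (v v' : {ffun 'I_a -> F}) (w : palette a) :
  (2 < a)%N -> p \in good_params -> p' \in good_params -> injective v ->
  fits_left p v w -> fits_left p' v' w -> xs_of p v = xs_of p' v' -> p = p' /\ v = v'.
Proof.
move=> a2 pg pg' vI /and3P[/forallP wc _ _] /and3P[/forallP wc' _ _] /ffunP e.
have ev : v = v'.
  by apply/ffunP => i; have := e i; rewrite !ffunE => /(congr1 snd).
move: v' ev wc' e => _ <- wc' e.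
have ec i : left_center p (v i) = left_center p' (v i).
  by have := e i; rewrite !ffunE => /(congr1 fst).
have es i : left_shift p (v i) = left_shift p' (v i).
  by rewrite -(eqP (wc i)) -(eqP (wc' i)).
split=> //; move: p p' pg pg' ec es {wc wc' e}.
move=> [[[[al0 al2] al1] [[be0 be1] de]] [[g0 g1] g2]].
move=> [[[[al0' al2'] al1'] [[be0' be1'] de']] [[g0' g1'] g2']].
rewrite !good_paramsE => /andP[al10 _] /andP[al10' _] ec es.
have eal i : quad al0 al1 al2 (v i) = quad al0' al1' al2' (v i).
  exact: (congr1 fst (ec i)).
have ebe i := congr1 snd (ec i); rewrite /= in ebe.
have eg i : quad g0 g1 g2 (v i) = quad g0' g1' g2' (v i).
  have := es i; rewrite /left_shift ec.
  by move=> /addIr/addrI.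
have [e0 e1 e2] := quad_eq3 a2 vI eal; have [f0 f1 f2] := quad_eq3 a2 vI ebe.
have [-> -> ->] := quad_eq3 a2 vI eg.
have ede : de = de'.
  by move: f2; rewrite -e1 -e2 -f1 => /(mulIf (invr_neq0 al10))/addrI.
by rewrite e0 e1 e2 f0 f1 ede.
Qed.

(** Averaging over all pairs of palettes: a parameter with injective sequences
    of scalars fits at least one in [palette_cost a * palette_cost b] of them. *)
Lemma exists_palettes_ffact (a b : nat) : (2 < a)%N -> (0 < b)%N ->
  exists (w : palette a) (w' : palette b),
    (#|good_params| * (#|F| ^_ a * #|F| ^_ b) <=
       palette_cost a * palette_cost b * #|bicliques (triple_rel w w') a b|)%N.
Proof.
move=> a2 b0.
pose S := setX good_params (setX [set v : {ffun 'I_a -> F} | injectiveb v]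
                                 [set u : {ffun 'I_b -> F} | injectiveb u]).
pose r (t : param * ({ffun 'I_a -> F} * {ffun 'I_b -> F}))
       (W : palette a * palette b) :=
  fits_left t.1 t.2.1 W.1 && fits_right t.1 t.2.2 W.2.
have cS : #|S| = (#|good_params| * (#|F| ^_ a * #|F| ^_ b))%N.
  by rewrite !cardsX !card_inj_ffuns !card_ord.
have SE p v u : ((p, (v, u)) \in S) = [&& p \in good_params, injectiveb v & injectiveb u].
  by rewrite !in_setX; congr (_ && (_ && _)); rewrite inE.
have W0 : (0 < #|{: palette a * palette b}|)%N.
  rewrite /palette !card_prod !card_ffun !card_ord !muln_gt0 !expn_gt0.
  by rewrite (ltnW (ltnW a2)) b0 (ltnW (finNzRing_gt1 F)).
have [[p [v u]]|[w w'] cw] :=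
  averaging (m := palette_cost a * palette_cost b) (S := S) (r := r) W0.
  rewrite SE => /and3P[pg /injectiveP vI /injectiveP uI].
  have -> : [set W | r (p, (v, u)) W] =
      setX [set w | fits_left p v w] [set w | fits_right p u w].
    by apply/setP => W; rewrite !inE.
  rewrite cardsX card_prod mulnACA leq_mul //; apply: card_fits => // i i'.
    by move/(left_center_inj pg)/vI.
  by move/(right_center_inj pg)/uI.
exists w, w'; rewrite -cS; apply: leq_trans cw _; rewrite leq_mul2l; apply/orP; right.
have inj : {in [set t in S | r t (w, w')] &,
    injective (fun t => (xs_of t.1 t.2.1, ys_of t.1 t.2.2))}.
  move=> [p [v u]] [p' [v' u']] tS tS'.
  move: tS; rewrite inE SE => /andP[/and3P[pg /injectiveP vI _] /andP[fl _]].
  move: tS'; rewrite inE SE => /andP[/and3P[pg' _ _] /andP[fl' _]] [ex ey].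
  have [-> ->] := xs_of_inj a2 pg pg' vI fl fl' ex; congr (_, (_, _)).
  by apply/ffunP => j; move/ffunP/(_ j): ey; rewrite !ffunE => /(congr1 snd).
rewrite -(card_in_imset inj); apply/subset_leq_card/subsetP.
move=> _ /imsetP[[p [v u]] + ->]; rewrite inE SE.
move=> /andP[/and3P[pg /injectiveP vI /injectiveP uI] /andP[fl fr]].
exact: fits_biclique.
Qed.

Lemma exists_palettes (a b : nat) :
  (2 < a)%N -> (0 < b)%N -> (2 * a <= #|F|)%N -> (2 * b <= #|F|)%N ->
  exists (w : palette a) (w' : palette b),
    (#|F| ^ 9 <= 4 * 2 ^ (a + b) * (a ^ a * a ^ a) * (b ^ b * b ^ b)
       * #|bicliques (triple_rel w w') a b|)%N.
Proof.
move=> a2 b0 aF bF; have [w [w' cnt]] := exists_palettes_ffact a2 b0; exists w, w'.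
have F1 := finNzRing_gt1 F.
set q := #|F| in aF bF cnt F1 *; set B := #|_| in cnt *.
have cg : #|good_params| = (q ^ 7 * (q.-1 * q.-1))%N.
  rewrite !cardsX !cardsT !card_prod !cardsC1 -/q.
  by rewrite [LHS](_ : _ = (q * q * (q * q) * (q * q * q)) * (q.-1 * q.-1))%N;
    [rewrite !expnS expn0; lia | lia].
(* The factors [q ^ a] and [q ^ b] count the choices of scalars on the data side
   and the values of the additive constants on the palette side: they cancel. *)
rewrite -(@leq_pmul2r (q ^ a * q ^ b)) ?muln_gt0 ?expn_gt0 ?(ltnW F1) //.
have hq : (q * q <= 4 * (q.-1 * q.-1))%N.
  by have : (q <= 2 * q.-1)%N; [lia | nia].
have ha := expn_le_ffact aF; have hb := expn_le_ffact bF.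
have : (q ^ 9 * (q ^ a * q ^ b) <=
   4 * 2 ^ (a + b) * (#|good_params| * (q ^_ a * q ^_ b)))%N.
  rewrite cg expnD; have -> : (q ^ 9 = q ^ 7 * (q * q))%N by rewrite (expnD q 7 2).
  apply: leq_trans (leq_mul (leq_mul (leqnn _) hq) (leq_mul ha hb)) _.
  by move: (q ^ 7)%N (q.-1 * q.-1)%N (2 ^ a)%N (2 ^ b)%N (q ^_ a)%N (q ^_ b)%N => *; lia.
move/leq_trans; apply.
apply: leq_trans (leq_mul (leqnn _) cnt) _; rewrite /palette_cost -/q.
by move: (2 ^ (a + b))%N (a ^ a)%N (b ^ b)%N (q ^ a)%N (q ^ b)%N => *; lia.
Qed.
End TripleConstruction.

(** * The two bounds together *)
Lemma few_common_leq (X Y : finType) (R : X -> Y -> bool) (s t0 t : nat) :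
  (t0 <= t)%N -> few_common R s t0 -> few_common R s t.
Proof. by move=> t0t few xs xI; apply: leq_trans (few _ xI) t0t. Qed.

Definition lower_bound (s a b M : nat) : Prop :=
  exists t0, forall t, (t0 <= t)%N -> exists n0, forall n, (n0 <= n)%N ->
    (n ^ s <= M * ex n (K a b) (K s t))%N.

(** Any prime above [b] serves, since only progressions of length at most [b]
    are used. *)
Lemma lower_bound2 (a b : nat) :
  (2 < a)%N -> (a <= b)%N -> exists M, lower_bound 2 a b M.
Proof.
move=> a2 ab; have [p bp pP] := prime_above b.
exists (2 ^ 2 * p ^ (2 * 2) * 2 * (a + b) ^ (a + b))%N, p.+1 => t pt.
apply: (@ex_lb_powers p 2 t a b 2 1) => //; first exact: prime_gt1.
  exact: leq_ltn_trans pt.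
move=> k k1; have [F pF cF] := PrimePowerField pP k1.
exists (F * F)%type, (F * F)%type, (@pair_rel F p); split.
- by rewrite card_prod cF.
- by rewrite card_prod cF.
- exact: few_common_leq pt (pair_rel_few pF).
- apply: few_common_leq pt _ => xs /(pair_rel_few pF).
  by under eq_finset do under eq_forallb do rewrite pair_rel_sym.
have bic : (#|F| ^ 3 * #|F|.-1 <= #|bicliques (@pair_rel F p) a b|)%N.
  apply: card_pair_bicliques => //; last exact: ltnW.
  - exact: ltnW a2.
  - exact: leq_trans (ltnW (ltnW a2)) ab.
  - exact: leq_trans ab (ltnW bp).
rewrite -cF; have half q : (1 < q -> q <= 2 * q.-1)%N by lia.
apply: leq_trans (leq_mul (leqnn 2) bic).
rewrite (expnSr _ 3) mulnCA leq_mul2l; apply/orP; right.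
exact: half (finNzRing_gt1 F).
Qed.

(** The prime 3 is one choice of an odd prime; oddness provides the division by 2
    in [right_center] and a nonsquare [d]. *)
Lemma lower_bound3 (a b : nat) :
  (3 < a)%N -> (a <= b)%N -> exists M, lower_bound 3 a b M.
Proof.
move=> a3 ab; pose M := (4 * 2 ^ (a + b) * (a ^ a * a ^ a) * (b ^ b * b ^ b))%N.
exists (2 ^ 3 * 3 ^ (3 * 3) * M * (a + b) ^ (a + b))%N, (b * 4).+1 => t bt.
apply: (@ex_lb_powers 3 3 t a b M (2 * b).+1) => //.
  exact: leq_trans bt.
move=> k bk; have k0 := leq_ltn_trans (leq0n _) bk.
have [F pF cF] := PrimePowerField (isT : prime 3) k0.
have two0 : (2%:R : F) != 0 by rewrite -(dvdn_pcharf pF).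
have [d dP] := exists_nonsquare two0.
have bF : (2 * b <= #|F|)%N.
  by rewrite cF (leq_trans (ltnW bk)) // ltnW // ltn_expl.
have aF : (2 * a <= #|F|)%N by apply: leq_trans bF; rewrite leq_mul2l.
have [||||w [w' bic]] := exists_palettes two0 dP (a := a) (b := b) => //.
- exact: ltnW a3.
- by case: (b) ab => // /(leq_trans a3).
exists (F * F * F)%type, (F * F * F)%type, (triple_rel d w w'); split.
- by rewrite !card_prod cF -mulnA.
- by rewrite !card_prod cF -mulnA.
- exact: few_common_leq bt (triple_rel_few two0 dP w w').
- have at4 : ((a * 4).+1 <= t)%N by apply: leq_trans bt; rewrite ltnS leq_mul2r ab orbT.
  apply: few_common_leq at4 _ => xs /(triple_rel_few two0 dP w' w).
  by under eq_finset do under eq_forallb do rewrite triple_relC.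
by rewrite -cF.
Qed.

Lemma lower_bound_leq (s a b M M' : nat) :
  (M <= M')%N -> lower_bound s a b M -> lower_bound s a b M'.
Proof.
move=> MM' [t0 H]; exists t0 => t /H[n0 H0]; exists n0 => n /H0 h.
by apply: leq_trans h _; rewrite leq_mul2r MM' orbT.
Qed.

(** Only finitely many [s] and [a] go with a given [b], so the constants can be
    added up over them. *)
Lemma uniform_lower_bound : exists M : nat -> nat,
  forall s a b, s = 2%N \/ s = 3%N -> (s < a)%N -> (a <= b)%N ->
  lower_bound s a b (M b).
Proof.
have /boolp.choice[m mP] (x : nat * nat * nat) : exists M,
    x.1.1 = 2%N \/ x.1.1 = 3%N -> (x.1.1 < x.1.2)%N -> (x.1.2 <= x.2)%N ->
    lower_bound x.1.1 x.1.2 x.2 M.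
  case: x => [[s a] b] /=.
  have [sab|N] := boolP [&& (s == 2) || (s == 3), s < a & a <= b]%N; last first.
    exists 0%N => s23 sa ab; case/negP: N; rewrite sa ab !andbT.
    by case: s23 => ->.
  case/and3P: sab => /orP[] /eqP-> sa ab.
    by have [M HM] := lower_bound2 sa ab; exists M.
  by have [M HM] := lower_bound3 sa ab; exists M.
exists (fun b => \sum_(a < b.+1) (m (2%N, a : nat, b) + m (3%N, a : nat, b)))%N.
move=> s a b s23 sa ab.
have := mP (s, a, b) s23 sa ab; apply: lower_bound_leq.
rewrite (bigD1 (inord a)) //= inordK // -addnA.
by case: s23 => ->; [rewrite leq_addr | rewrite addnCA leq_addr].
Qed.

Theorem theorem1p1 (R : realType) :
  exists c C : nat -> nat -> R,
    (forall t b : nat, 0 < c t b /\ 0 < C t b) /\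
    forall s a b : nat, (s = 2%N \/ s = 3%N) -> (s < a)%N -> (a <= b)%N ->
    exists t0 : nat, forall t : nat, (t0 <= t)%N ->
    exists n0 : nat, forall n : nat, (n0 <= n)%N ->
      c t b * n%:R ^+ s <= (ex n (K a b) (K s t))%:R /\
      (ex n (K a b) (K s t))%:R <= C t b * n%:R ^+ s.
Proof.
have [M MP] := uniform_lower_bound.
exists (fun _ b => (M b).+1%:R^-1), (fun t b => (t.+1 ^ (b + b))%:R); split.
  by move=> t b; rewrite invr_gt0 !ltr0n expn_gt0.
move=> s a b s23 sa ab; have [t0 lb] := MP s a b s23 sa ab.
exists t0 => t /lb[n0 {}lb]; exists n0 => n /lb {}lb.
rewrite mulrC ler_pdivrMr ?ltr0n // -natrX -!natrM !ler_nat; split.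
  by rewrite mulnC (leq_trans lb) // leq_mul2r leqnSn orbT.
have sb := leq_trans sa ab.
apply: leq_trans (ex_ub n t (ltnW sa) (ltnW sb)) _.
by rewrite mulnC leq_mul2r leq_pexp2l ?leq_add2r ?ab ?orbT.
Qed.
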